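(* Let $\mu$ be a Radon measure on $\mathbb{R}$ with positive Fourier dimension. Then for $\mu$-almost all real numbers $x$, the number $\sum_{n=1}^\infty \frac{[\prod_{j=1}^{n-1} j^j x]}{\prod_{j=1}^n j^j}$ is irrational.
   Context: For a real number $y$, $[y]$ denotes the integer part of $y$; in the numerator, $[\prod_{j=1}^{n-1} j^j x]$ means $[x\prod_{j=1}^{n-1} j^j]$. For a Radon measure $\mu$ on $\mathbb{R}$, its Fourier transform is $\hat{\mu}(t)=\int_{-\infty}^\infty e^{-2\pi i x t}\,d\mu(x)$, and its Fourier dimension is $\dim_F(\mu)=\sup\{\eta\ge 0 : |\hat{\mu}(t)|\ll (1+|t|)^{-\eta/2}\}$. ''Positive Fourier dimension'' means $\dim_F(\mu)>0$. *)

(* Defs.v *)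
From HB Require Import structures.
From mathcomp Require Import all_boot all_order all_algebra.
From mathcomp Require Import all_classical all_reals all_analysis.
From mathcomp Require Import complex.

Set Implicit Arguments.
Unset Strict Implicit.
Unset Printing Implicit Defensive.

Import Order.TTheory GRing.Theory Num.Theory.
Import numFieldNormedType.Exports.

Local Open Scope classical_set_scope.
Local Open Scope ring_scope.

(* Locally finite and inner regular Borel measure; on the real line the second
   condition follows from the first. *)
Definition radon_measure (R : realType)
    (mu : {measure set (measurableTypeR R) -> \bar R}) : Prop :=
  (forall K : set R, compact K -> (mu K < +oo)%E) /\
  (forall A : set R, measurable (A : set (measurableTypeR R)) ->
     mu A = ereal_sup [set mu K | K in [set K : set R | compact K /\ K `<=` A]]).

(* exp (-2 i pi x t) = cos (2 pi x t) - i sin (2 pi x t), integrated componentwise;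
   [Rintegral] is 0 when the integral is infinite or undefined, see
   [fourier_exists]. *)
Definition fourier (R : realType)
    (mu : {measure set (measurableTypeR R) -> \bar R}) (t : R) : R[i] :=
  (Rintegral mu setT (fun x : R => cos (2 * pi * x * t))
   +i* - Rintegral mu setT (fun x : R => sin (2 * pi * x * t)))%C.

Definition fourier_exists (R : realType)
    (mu : {measure set (measurableTypeR R) -> \bar R}) (t : R) : Prop :=
  mu.-integrable setT (fun x : R => (cos (2 * pi * x * t))%:E) /\
  mu.-integrable setT (fun x : R => (sin (2 * pi * x * t))%:E).

(* [ComplexField.Normc.normc] is the real-valued modulus. *)
Definition fourier_decay (R : realType)
    (mu : {measure set (measurableTypeR R) -> \bar R}) (eta : R) : Prop :=
  (forall t : R, fourier_exists mu t) /\
  exists C : R, forall t : R,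
    ComplexField.Normc.normc (fourier mu t) <= C * (1 + `|t|) `^ (- (eta / 2)).

(* Extended-real valued: the supremum may be infinite (for instance for the
   Gaussian measure). It is -oo when the Fourier transform does not exist, which
   happens exactly when mu is infinite (take t = 0). *)
Definition fourier_dim (R : realType)
    (mu : {measure set (measurableTypeR R) -> \bar R}) : \bar R :=
  ereal_sup [set eta%:E | eta in [set eta : R | 0 <= eta /\ fourier_decay mu eta]].

Definition hyperfact (n : nat) : nat := (\prod_(1 <= j < n.+1) j ^ j)%N.

Definition hyperfact_term (R : realType) (x : R) (n : nat) : R :=
  (Num.floor (x * (hyperfact n.-1)%:R))%:~R / (hyperfact n)%:R.

Definition hyperfact_sum (R : realType) (x : R) : R :=
  limn (fun N : nat => \sum_(1 <= n < N.+1) hyperfact_term x n).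

(* Main.v *)
Require Import Defs.
From HB Require Import structures.
From mathcomp Require Import all_boot all_order all_algebra.
From mathcomp Require Import all_classical all_reals all_analysis.
From mathcomp Require Import complex.
From mathcomp Require Import measurable_realfun zify ring lra.

Set Implicit Arguments.
Unset Strict Implicit.
Unset Printing Implicit Defensive.

Import Order.TTheory GRing.Theory Num.Theory.
Import numFieldNormedType.Exports.

Local Open Scope classical_set_scope.
Local Open Scope ring_scope.

(* Write H_n for the hyperfactorial and t_N = H_N \sum_(n > N) n^-n. Replacing
   the integer part [x H_(n-1)] by x H_(n-1) minus a fractional part shows that
   H_N times the N-th tail of the series is t_N x up to an error O(1 / N). If
   the sum is rational, its product with H_N is an integer for large N, so the
   distance from t_N x to the integers tends to 0. As t_N tends to infinity and
   the Fourier transform of mu vanishes at infinity, this happens only on a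
   null set: if A is the mean of cos (2 pi k y) over k = 1 .. K, the integral
   of A(t_N x)^2 tends to mu(R) / (2 K), whereas A(t_N x)^2 tends to 1 on the
   exceptional set, whose measure is therefore at most mu(R) / (2 K) by Fatou's
   lemma, for every K. *)

(** * Divisibility and growth of hyperfactorials *)

Lemma hyperfactS n : hyperfact n.+1 = (hyperfact n * n.+1 ^ n.+1)%N.
Proof. by rewrite /hyperfact big_nat_recr. Qed.

Lemma hyperfact_gt0 n : (0 < hyperfact n)%N.
Proof.
elim: n => [|n IH]; first by rewrite /hyperfact big_geq.
by rewrite hyperfactS muln_gt0 IH expn_gt0.
Qed.

Lemma dvdn_hyperfact m n : (m <= n)%N -> (hyperfact m %| hyperfact n)%N.
Proof.
move=> /subnK <-; elim: (n - m)%N => // k IH.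
by rewrite addSn hyperfactS dvdn_mulr.
Qed.

Lemma dvdn_hyperfact_le q n : (0 < q <= n)%N -> (q %| hyperfact n)%N.
Proof.
case: q => // q /= /dvdn_hyperfact; apply: dvdn_trans.
by rewrite hyperfactS expnS dvdn_mull ?dvdn_mulr.
Qed.

Lemma leq_hyperfact n : (n <= hyperfact n)%N.
Proof.
case: n => // n; apply: dvdn_leq; first exact: hyperfact_gt0.
by apply: dvdn_hyperfact_le; rewrite leqnn.
Qed.

(** The last three factors of the hyperfactorial are at least (k+3)^(3k+12) = ((k+3)^2)^(k+6), which
    dominates (k+6)^(k+6); what remains is [hyperfact k.+2], at least k + 2. *)
Lemma hyperfact_growth k : (k.+2 * k.+4.+2 ^ k.+4.+2 <= hyperfact k.+4.+1)%N.
Proof.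
have sq : (k.+4.+2 <= k.+3 ^ 2)%N by rewrite expnS expn1; nia.
rewrite 3!hyperfactS -2!(mulnA (hyperfact k.+2)).
apply: leq_mul; first exact: leq_hyperfact.
apply: (@leq_trans (k.+3 ^ (2 * k.+4.+2))); first by rewrite expnM leq_exp2r.
apply: (@leq_trans (k.+3 ^ k.+3 * k.+3 ^ k.+4 * k.+3 ^ k.+4.+1)).
  by rewrite -!expnD leq_exp2l//; lia.
apply: leq_mul; last by rewrite leq_exp2r// leqW.
by apply: leq_mul; last by rewrite leq_exp2r.
Qed.

Lemma double_selfpow_le n : (2 * n.+1 ^ n.+1 <= n.+2 ^ n.+2)%N.
Proof. by rewrite [(n.+2 ^ _)%N]expnS leq_mul// leq_exp2r. Qed.

Lemma lef_natV (R : numFieldType) (m n : nat) : (0 < m)%N -> (m <= n)%N ->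
  n%:R^-1 <= m%:R^-1 :> R.
Proof.
move=> m0 mn; rewrite lef_pV2 ?posrE ?ltr0n ?ler_nat//.
exact: leq_trans m0 mn.
Qed.

(** * Series dominated by telescoping differences *)

Section telescoping_majorant.
Context {R : realType}.
Variables u v : R^nat.
Hypothesis u_ge0 : forall n, 0 <= u n.
Hypothesis v_ge0 : forall n, 0 <= v n.
Hypothesis le_uv : forall n, u n <= v n - v n.+1.

(** By [le_uv], the sequence [series u n + v n] never increases; this bounds the series and makes
    [v n] a bound for its tail. *)
Let le_series m k : series u (k + m)%N + v (k + m)%N <= series u m + v m.
Proof.
elim: k => // k; apply: le_trans; rewrite addSn seriesSr.
by have := le_uv (k + m); lra.
Qed.

Lemma is_cvg_series_telescoping : cvgn (series u).
Proof.
apply: nondecreasing_is_cvgn; first exact: nondecreasing_series.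
exists (v 0%N) => _ [n _ <-]; have := le_series 0 n; have := v_ge0 n.
by rewrite addn0 [series u 0]big_geq//; lra.
Qed.

Lemma series_telescoping_ge n : series u n + u n <= limn (series u).
Proof.
rewrite -seriesSr.
apply: nondecreasing_cvgn_le; first exact: nondecreasing_series.
exact: is_cvg_series_telescoping.
Qed.

Lemma series_telescoping_le n : limn (series u) <= series u n + v n.
Proof.
apply: limr_le; first exact: is_cvg_series_telescoping.
exists n => // m /= nm; have := le_series n (m - n); have := v_ge0 m.
by rewrite subnK//; lra.
Qed.

End telescoping_majorant.

(** * Rational sums force near-integers *)

Section rational_sum.
Context {R : realType}.

Local Notation H n := ((hyperfact n)%:R : R).

(* [series] sums from index 0, so the term of index n >= 1 of the paper's sum
   is decomposed here at n.-1. *)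
Definition selfpow_inv n : R := ((n.+1 ^ n.+1)%N%:R)^-1.

Definition frac_term (x : R) n : R :=
  (x * H n - (Num.floor (x * H n))%:~R) / H n.+1.

Local Notation a := selfpow_inv.
Local Notation w := frac_term.

Let H_gt0 n : 0 < H n. Proof. by rewrite ltr0n hyperfact_gt0. Qed.

Let a_gt0 n : 0 < a n. Proof. by rewrite invr_gt0 ltr0n expn_gt0. Qed.

Let HS n : H n / H n.+1 = a n.
Proof.
rewrite hyperfactS natrM invfM mulrA divff ?mul1r//.
by rewrite pnatr_eq0 -lt0n hyperfact_gt0.
Qed.

Let le_a n : a n <= 2 * a n - 2 * a n.+1.
Proof.
suff : 2 * a n.+1 <= a n by lra.
rewrite -ler_pdivlMl// -invfM -natrM.
by apply: lef_natV; rewrite ?double_selfpow_le// muln_gt0 expn_gt0.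
Qed.

Let w_ge0 x n : 0 <= w x n.
Proof. by rewrite divr_ge0 ?ler0n// subr_ge0 floor_le. Qed.

(** The numerator of [w x n] is a fractional part, hence below 1, and hyperfactorials at least
    double from index n + 1 to n + 2. *)
Let le_w x n : w x n <= 2 * (H n.+1)^-1 - 2 * (H n.+2)^-1.
Proof.
have w1 : w x n <= (H n.+1)^-1.
  rewrite ler_pdivrMr// mulVf ?gt_eqF// lerBlDr addrC ltW//.
  by rewrite -[X in _ + X]/(1%:~R) -rmorphD/= floorD1_gt.
have : 2 * (H n.+2)^-1 <= (H n.+1)^-1.
  rewrite -ler_pdivlMl// -invfM -natrM.
  apply: lef_natV; first by rewrite muln_gt0 hyperfact_gt0.
  rewrite [hyperfact n.+2]hyperfactS mulnC leq_mul2l expnS.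
  by apply/orP; right; apply: (@leq_mul 2 1) => //; rewrite expn_gt0.
lra.
Qed.

Let a2_ge0 n : 0 <= 2 * a n. Proof. by rewrite mulr_ge0// ltW. Qed.

Let H2_ge0 n : 0 <= 2 * (H n.+1)^-1.
Proof. by rewrite mulr_ge0// invr_ge0 ltW. Qed.

Let cvg_a : cvgn (series a).
Proof.
exact: is_cvg_series_telescoping (fun n => ltW (a_gt0 n)) a2_ge0 le_a.
Qed.

Let cvg_w x : cvgn (series (w x)).
Proof. exact: is_cvg_series_telescoping (w_ge0 x) H2_ge0 (le_w x). Qed.

(** This is t_N: [series a N] ends with N^-N, so the tail starts at (N+1)^-(N+1). *)
Definition hyperfact_freq N : R := H N * (limn (series a) - series a N).

Lemma hyperfact_freq_cvgy : hyperfact_freq N @[N --> \oo] --> +oo.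
Proof.
(* With N = n + 5, the first term of the tail alone, times H_N, is at least N - 3. *)
have Hle n : (n.+2)%:R <= hyperfact_freq n.+4.+1.
  have tail : a n.+4.+1 <= limn (series a) - series a n.+4.+1.
    rewrite lerBrDl.
    exact: (series_telescoping_ge (fun n => ltW (a_gt0 n)) a2_ge0 le_a).
  apply: (le_trans _ (ler_wpM2l (ltW (H_gt0 _)) tail)).
  rewrite /a -ler_pdivrMr// ?invr_gt0 ?ltr0n ?expn_gt0// invrK.
  by rewrite -natrM ler_nat hyperfact_growth.
apply/cvgryPge => A.
near=> N.
have N5 : (5 <= N)%N by near: N; exists 5%N.
have AN : A <= (N - 3)%:R.
  near: N; exists (Num.truncn `|A| + 4)%N => // m /= Hm.
  apply: (le_trans (ler_norm _)); apply: ltW.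
  apply: (lt_le_trans (truncnS_gt _)); rewrite ler_nat.
  by rewrite ltn_subRL addnC -addn1 -addnA.
apply: (le_trans AN); have -> : N = (N - 5).+4.+1 by lia.
by apply: le_trans (Hle _); rewrite ler_nat; lia.
Unshelve. all: by end_near. Qed.

Lemma hyperfact_partial_sum (x : R) N :
  \sum_(1 <= n < N.+1) hyperfact_term x n = x * series a N - series (w x) N.
Proof.
rewrite big_add1/= mulr_sumr -sumrB; apply: eq_bigr => n _.
rewrite /hyperfact_term/= /w mulrBl opprB addrC.
by rewrite -(HS n) mulrA subrK.
Qed.

Lemma hyperfact_sumE (x : R) :
  hyperfact_sum x = x * limn (series a) - limn (series (w x)).
Proof.
rewrite /hyperfact_sum; under eq_fun do rewrite hyperfact_partial_sum.
apply/cvg_lim => //; apply: cvgB; last exact: cvg_w.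
by apply: cvgMr; exact: cvg_a.
Qed.

Lemma hyperfact_partial_sum_int (x : R) N :
  H N * (\sum_(1 <= n < N.+1) hyperfact_term x n) \is a Num.int.
Proof.
rewrite mulr_sumr big_nat_cond; apply: rpred_sum => n /andP[/andP[_ nN] _].
rewrite /hyperfact_term mulrCA; apply: rpredM; first exact: intr_int.
have /dvdnP[k ->] := @dvdn_hyperfact n N nN.
by rewrite natrM mulfK ?natr_int// pnatr_eq0 -lt0n hyperfact_gt0.
Qed.

Lemma rational_hyperfact_sum_int (x : R) : rational (hyperfact_sum x) ->
  \forall N \near \oo, H N * hyperfact_sum x \is a Num.int.
Proof.
case=> q _ <-; exists `|denq q|%N => // N /= qN.
have /dvdnP[k Hk] : (`|denq q| %| hyperfact N)%N.
  by apply: dvdn_hyperfact_le; rewrite qN absz_gt0 denq_neq0.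
rewrite Hk natrM -mulrA; apply: rpredM; first exact: natr_int.
have -> : (`|denq q|%N%:R : R) = (denq q)%:~R.
  by rewrite pmulrn gez0_abs// ltW// denq_gt0.
rewrite /ratr mulrC divfK; first exact: intr_int.
by rewrite intr_eq0 denq_neq0.
Qed.

Lemma rational_hyperfact_sum_freq (x : R) : rational (hyperfact_sum x) ->
  exists m : nat -> int, hyperfact_freq N * x - (m N)%:~R @[N --> \oo] --> 0.
Proof.
move=> /rational_hyperfact_sum_int qS.
pose P N := \sum_(1 <= n < N.+1) hyperfact_term x n.
(* The floor only serves to define an integer for every N; it changes nothing once H_N times the sum
   is an integer. *)
exists (fun N => Num.floor (H N * (hyperfact_sum x - P N))).
apply: (@squeeze_cvgr _ _ _ _ (fun=> 0) (fun N => 2 * (N.+1%:R)^-1)).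
- near=> N.
  have HS_int : H N * hyperfact_sum x \is a Num.int by near: N.
  rewrite floorK; last by rewrite mulrBr rpredB// hyperfact_partial_sum_int.
  have -> : hyperfact_freq N * x - H N * (hyperfact_sum x - P N) =
      H N * (limn (series (w x)) - series (w x) N).
    rewrite /hyperfact_freq /P hyperfact_sumE hyperfact_partial_sum; ring.
  apply/andP; split.
    apply: mulr_ge0; first exact: ltW.
    rewrite subr_ge0.
    apply: le_trans (series_telescoping_ge (w_ge0 x) H2_ge0 (le_w x) N).
    by rewrite lerDl.
  (* The tail of [series (w x)] is at most 2 / H_(N+1), and H_N / H_(N+1) = (N+1)^-(N+1) is at most
     1 / (N+1). *)
  apply: (@le_trans _ _ (H N * (2 * (H N.+1)^-1))).
    rewrite ler_pM2l// lerBlDl.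
    exact: (series_telescoping_le (w_ge0 x) H2_ge0 (le_w x) N).
  rewrite mulrCA HS ler_pM2l//; apply: lef_natV => //.
  by rewrite expnS leq_pmulr// expn_gt0.
- exact: cvg_cst.
- rewrite -[X in _ --> X](mulr0 2); apply: cvgMr.
  exact: cvg_harmonic.
Unshelve. all: by end_near. Qed.

End rational_sum.

(** * Cosine identities and limits of integrals *)

Lemma cosM (R : realType) (x y : R) :
  cos x * cos y = 2^-1 * cos (x - y) + 2^-1 * cos (x + y).
Proof. by rewrite cosB cosD; lra. Qed.

Lemma cosD_2piz (R : realType) (x : R) (m : int) :
  cos (x + 2 * pi * m%:~R) = cos x.
Proof.
have nat_case (y : R) (n : nat) : cos (y + 2 * pi * n%:R) = cos y.
  elim: n => [|n IH]; first by rewrite mulr0 addr0.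
  rewrite -[RHS]IH -[RHS]cosD2pi; congr cos; rewrite -natr1 -mulr_natl; ring.
case: m => n; first by rewrite -pmulrn nat_case.
by rewrite NegzE mulrNz mulrN -pmulrn -[LHS](nat_case _ n.+1) subrK.
Qed.

Section mean_cvg.
Context d (T : measurableType d) (R : realType).
Variable mu : {measure set T -> \bar R}.

(** Integrability is bundled with the limit because linearity of [Rintegral] requires it. *)
Definition mean_cvg (f : nat -> T -> R) (l : R) :=
  (forall n, mu.-integrable setT (EFin \o f n)) /\
  Rintegral mu setT (f n) @[n --> \oo] --> l.

Lemma mean_cvgD f g k l : mean_cvg f k -> mean_cvg g l ->
  mean_cvg (fun n x => f n x + g n x) (k + l).
Proof.
move=> [intf cf] [intg cg]; split.
  by move=> n; exact: (integrableD _ (intf n) (intg n)).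
under eq_fun do rewrite RintegralD//.
exact: cvgD.
Qed.

Lemma mean_cvgZ f l r : mean_cvg f l -> mean_cvg (fun n x => r * f n x) (r * l).
Proof.
move=> [intf cf]; split.
  by move=> n; exact: (integrableZl _ r (intf n)).
under eq_fun do rewrite RintegralZl//.
exact: cvgMr.
Qed.

Lemma mean_cvg0 : mean_cvg (fun=> cst 0) 0.
Proof.
split; first by move=> n; exact: integrable0.
under eq_fun do rewrite Rintegral_cst// mul0r.
exact: cvg_cst.
Qed.

Lemma mean_cvg_sum (I : Type) (s : seq I) (f : I -> nat -> T -> R)
    (l : I -> R) :
  (forall i, mean_cvg (f i) (l i)) ->
  mean_cvg (fun n x => \sum_(i <- s) f i n x) (\sum_(i <- s) l i).
Proof.
move=> fl; elim: s => [|i s IH].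
  rewrite big_nil; under eq_fun do under eq_fun do rewrite big_nil.
  exact: mean_cvg0.
rewrite big_cons; under eq_fun do under eq_fun do rewrite big_cons.
exact: mean_cvgD.
Qed.

End mean_cvg.

(** * Null sets from vanishing cosine integrals *)

Section rajchman.
Context {R : realType} (mu : {measure set (measurableTypeR R) -> \bar R}).

Definition cos_avg (K : nat) (y : R) : R :=
  K%:R^-1 * \sum_(k < K) cos (2 * pi * (k.+1%:R * y)).

Hypothesis cos_integrable :
  forall t : R, mu.-integrable setT (fun x : R => (cos (2 * pi * x * t))%:E).

Hypothesis cos_cvg0 : forall t : R^nat, `|t n| @[n --> \oo] --> +oo ->
  Rintegral mu setT (fun x : R => cos (2 * pi * x * t n)) @[n --> \oo] --> 0.

Variable t : R^nat.
Hypothesis t_cvgy : t n @[n --> \oo] --> +oo.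

(** The total mass is finite, by [cos_integrable] at frequency 0, so [fine] does not fall back on
    its default value. *)
Let M := fine (mu setT).

(** Frequency 0 gives the total mass. Otherwise the frequencies are unbounded, possibly towards -oo,
    hence the absolute value in [cos_cvg0]. *)
Lemma mean_cvg_cos (r : R) :
  mean_cvg mu (fun n x => cos (2 * pi * x * (r * t n))) ((r == 0)%:R * M).
Proof.
split; first by move=> n; exact: cos_integrable.
have [->|r0] := eqVneq r 0.
  under eq_fun do under eq_fun do rewrite mul0r mulr0 cos0.
  under eq_fun do rewrite Rintegral_cst//.
  exact: cvg_cst.
rewrite mul0r; apply: cos_cvg0.
apply/cvgryPge => A.
move/cvgryPge : t_cvgy => /(_ (A / `|r|)); apply: filterS => n.
rewrite ler_pdivrMr ?normr_gt0// => /le_trans; apply.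
by rewrite normrM mulrC ler_pM2l ?normr_gt0// ler_norm.
Qed.

Lemma mean_cvg_cos_avg K : (0 < K)%N ->
  mean_cvg mu (fun n x => cos_avg K (t n * x) ^+ 2) ((2 * K%:R)^-1 * M).
Proof.
move=> K0.
pose f (j k : 'I_K) n (x : R) := K%:R^-2 * (
  2^-1 * cos (2 * pi * x * ((j%:R - k%:R) * t n)) +
  2^-1 * cos (2 * pi * x * ((j.+1%:R + k.+1%:R) * t n))).
pose l (j k : 'I_K) : R := K%:R ^- 2 * (
  2^-1 * ((j%:R - k%:R == 0 :> R)%:R * M) +
  2^-1 * ((j.+1%:R + k.+1%:R == 0 :> R)%:R * M)).
have fl :
    mean_cvg mu (fun n x => \sum_j \sum_k f j k n x) (\sum_j \sum_k l j k).
  do 2![apply: mean_cvg_sum => ?].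
  by apply/mean_cvgZ/mean_cvgD; apply/mean_cvgZ/mean_cvg_cos.
have -> : (fun n x => cos_avg K (t n * x) ^+ 2) =
    (fun n x => \sum_j \sum_k f j k n x).
  apply/funext => n; apply/funext => x.
  rewrite /cos_avg exprMn exprVn [X in _ * X]expr2 mulr_suml mulr_sumr.
  apply: eq_bigr => j _; rewrite mulr_sumr mulr_sumr; apply: eq_bigr => k _.
  rewrite /f cosM; congr (_ * (_ * cos _ + _ * cos _)); rewrite -?natr1; ring.
suff <- : \sum_j \sum_k l j k = (2 * K%:R)^-1 * M by [].
(* The sum frequencies j + k + 2 never vanish and the differences vanish only on the diagonal, so K
   terms M / (2 K^2) survive. *)
have lE j k : l j k = (if k == j then (2 * K%:R ^+ 2)^-1 * M else 0).
  rewrite /l -natrD pnatr_eq0 addSn/= mul0r mulr0 addr0 subr_eq0 eqr_nat.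
  rewrite [(k == j)]eq_sym; have -> : (val j == val k) = (j == k) by [].
  by case: (j == k); rewrite ?mul0r ?mulr0// mul1r mulrA -invfM [2 * _]mulrC.
under eq_bigr => j _ do under eq_bigr => k _ do rewrite lE.
under eq_bigr => j _ do rewrite -big_mkcond/= big_pred1_eq.
rewrite sumr_const card_ord -mulrnAl; congr (_ * _).
by rewrite -mulr_natr !invfM -!mulrA mulVf ?mulr1// pnatr_eq0 -lt0n.
Qed.

Lemma measurable_cos_avg K (s : R) :
  measurable_fun setT
    ((fun x => (cos_avg K (s * x) ^+ 2)%:E) : measurableTypeR R -> \bar R).
Proof.
apply/measurable_EFinP; apply: measurable_funX.
apply: measurable_funM => //; apply: measurable_sum => k.
apply: continuous_measurable_fun => x.
apply: continuous_comp; last exact: continuous_cos.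
by do 3![apply: cvgM; first exact: cvg_cst].
Qed.

(** [cos_avg K] has period 1, is continuous, and equals 1 at 0. *)
Lemma cos_avg_cvg1 K (u : R^nat) (m : nat -> int) : (0 < K)%N ->
  (u n - (m n)%:~R) @[n --> \oo] --> 0 ->
  cos_avg K (u n) ^+ 2 @[n --> \oo] --> (1 : R).
Proof.
move=> K0 um.
have uE n : cos_avg K (u n) = cos_avg K (u n - (m n)%:~R).
  congr (_ * _); apply: eq_bigr => k _.
  rewrite -[RHS](cosD_2piz _ (k.+1%:Z * m n)).
  by congr cos; rewrite intrM -pmulrn; ring.
under eq_fun do rewrite uE.
suff cos_avg1 : cos_avg K (u n - (m n)%:~R) @[n --> \oo] --> (1 : R).
  under eq_fun do rewrite expr2.
  by rewrite -[X in nbhs X](mulr1 1); exact: cvgM.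
have cos_avg0 : cos_avg K 0 = 1 :> R.
  rewrite /cos_avg; under eq_bigr do rewrite 2!mulr0 cos0.
  by rewrite sumr_const card_ord mulVf// pnatr_eq0 -lt0n.
suff : cos_avg K (u n - (m n)%:~R) @[n --> \oo] --> cos_avg K 0.
  by rewrite cos_avg0.
apply: cvgMr; apply: cvg_big => [|k _]; first exact: add_continuous.
apply: continuous_cvg; first exact: continuous_cos.
by do 2!apply: cvgMr.
Qed.

Lemma negligible_near_int :
  mu.-negligible [set x : R | exists m : nat -> int,
    t n * x - (m n)%:~R @[n --> \oo] --> 0].
Proof.
pose g K n (x : measurableTypeR R) : \bar R := (cos_avg K.+1 (t n * x) ^+ 2)%:E.
(* The lower limit exists at every point and is measurable, which Fatou's lemma needs. *)
pose h K (x : measurableTypeR R) := limn_einf (fun n => g K n x).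
have g_ge0 K n x : (0 <= g K n x)%E by rewrite lee_fin sqr_ge0.
have mh K : measurable_fun setT (h K).
  rewrite /h /limn_einf; apply: measurableT_comp => //.
  apply: measurable_fun_limn_esup => n.
  by apply: measurableT_comp => //; exact: measurable_cos_avg.
have h_ge0 K x : (0 <= h K x)%E.
  rewrite /h limn_einf_lim; apply: lime_ge; first exact: is_cvg_einfs.
  by near=> n; apply: le_ereal_inf_tmp => _ [k _ <-].
have h_int K : (\int[mu]_x h K x <= ((2 * K.+1%:R)^-1 * M)%:E)%E.
  have [intg cg] := mean_cvg_cos_avg (ltn0Sn K).
  have gE n : (\int[mu]_x g K n x)%E =
      (Rintegral mu setT (fun x => cos_avg K.+1 (t n * x) ^+ 2))%:E.
    by rewrite /Rintegral fineK//; exact: integrable_fin_num (intg n).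
  have := fatou mu measurableT (fun n => measurable_cos_avg K.+1 (t n))
    (fun n x _ => g_ge0 K n x).
  move/le_trans; apply; rewrite le_eqVlt; apply/orP; left; apply/eqP.
  apply: (cvg_limn_einf_sup _).1; under eq_fun do rewrite gE.
  by apply: cvg_EFin => //; exact: nearW.
(* Negligibility asks for a measurable null set containing the exceptional set; [B] is such a
   cover. *)
pose B := \bigcap_K (setT `&` [set x | (1%:E <= h K x)%E]).
have mB : measurable B.
  by apply: bigcapT_measurable => K; exact: emeasurable_fun_c_infty.
exists B; split => //.
- apply/eqP; rewrite -measure_le0.
  (* Markov's inequality: the indicator of [B] is at most [h K]. *)
  have leB K : (mu B <= ((2 * K.+1%:R)^-1 * M)%:E)%E.
    apply: le_trans (h_int K); rewrite -[B]setIT -integral_indic//.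
    apply: ge0_le_integral => //; first exact/measurable_EFinP.
    move=> x _; rewrite indicE.
    case: (boolP (x \in B)) => [|_]; last exact: h_ge0.
    by rewrite inE => /(_ K I)[].
  have lim0 : ((2 * K.+1%:R)^-1 * M)%:E @[K --> \oo] --> 0%:E.
    apply: cvg_EFin; first exact: nearW.
    rewrite -(mul0r M); apply: cvgMl.
    under eq_fun do rewrite invfM; rewrite -(mulr0 2^-1); apply: cvgMr.
    exact: cvg_harmonic.
  by apply: (cvge_to_ge lim0); exact: nearW.
- move=> x [m mx] K _; split => //=.
  rewrite /h (_ : limn_einf _ = 1%:E)//.
  apply: (cvg_limn_einf_sup _).1; apply: cvg_EFin; first exact: nearW.
  exact: cos_avg_cvg1 mx.
Unshelve. all: by end_near. Qed.

End rajchman.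

(** * From Fourier decay to vanishing cosine integrals *)

Lemma norm_Re_le_normc (R : rcfType) (x y : R) :
  `|x| <= ComplexField.Normc.normc (x +i* y)%C.
Proof. by rewrite /= -sqrtr_sqr ler_wsqrtr// lerDl sqr_ge0. Qed.

Lemma powRN_small (R : realType) (h C e : R) : 0 < h -> 0 < e ->
  exists A : R, forall y, A <= y -> C * y `^ (- h) < e.
Proof.
(* Once y^h is at least [D], C y^-h is at most C / D, below e; adding 1 to |C| makes this strict and
   keeps [D] positive. *)
move=> h0 e0; pose D := (`|C| + 1) / e.
have D0 : 0 < D by rewrite divr_gt0// ltr_wpDl.
exists (D `^ h^-1) => y Dy.
have Dyh : D <= y `^ h.
  have -> : D = (D `^ h^-1) `^ h.
    by rewrite -powRrM mulVf ?gt_eqF// powRr1// ltW.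
  have y0 : 0 <= y by exact: le_trans (powR_ge0 _ _) Dy.
  by have := ge0_ler_powR (ltW h0); apply => //; rewrite nnegrE// powR_ge0.
rewrite powRN ltr_pdivrMr; last exact: lt_le_trans Dyh.
apply: (@lt_le_trans _ _ (e * D)); last by rewrite ler_pM2l.
by rewrite mulrC divfK ?gt_eqF// (le_lt_trans (ler_norm _))// ltrDl.
Qed.

(** The cosine integral is the real part of [fourier], so the decay of the modulus controls it. *)
Lemma fourier_decay_cos_cvg0 (R : realType)
    (mu : {measure set (measurableTypeR R) -> \bar R}) (eta : R) (t : R^nat) :
  0 < eta -> fourier_decay mu eta -> `|t n| @[n --> \oo] --> +oo ->
  Rintegral mu setT (fun x : R => cos (2 * pi * x * t n)) @[n --> \oo] --> 0.
Proof.
move=> eta0 [_ [C decay]] ty; apply/cvgr0Pnorm_lt => e e0.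
have [A smallA] := @powRN_small R (eta / 2) C e (divr_gt0 eta0 (ltr0Sn _ _)) e0.
move/cvgryPge : ty => /(_ A); apply: filterS => n At.
apply: le_lt_trans (norm_Re_le_normc _ _) _; apply: le_lt_trans (decay (t n)) _.
by apply: smallA; rewrite (le_trans At)// lerDr.
Qed.

Theorem theorem4 (R : realType)
    (mu : {measure set (measurableTypeR R) -> \bar R})
    (mu_radon : radon_measure mu) (mu_dim : (0 < fourier_dim mu)%E) :
  {ae mu, forall x : R, irrational (hyperfact_sum x)}.
Proof.
(* A positive supremum yields an admissible exponent [eta] that is itself positive. *)
have [_ [eta [_ decay] <-]] := ereal_sup_gt mu_dim; rewrite lte_fin => eta0.
apply: negligibleS (negligible_near_int (fun t => (decay.1 t).1)
  (fun t => fourier_decay_cos_cvg0 eta0 decay) (@hyperfact_freq_cvgy R)).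
by move=> x /= /contrapT/rational_hyperfact_sum_freq.
Qed.
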